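(* Every syndetically distal compact flow $(T,X)$ ($T$ a Hausdorff topological group, $X$ a compact Hausdorff space) is pointwise Bohr a.p.; that is, for every $x\in X$ the subflow $(T,\overline{Tx})$ is an a.p. flow.
   Context: $\mathscr U_X$ is the uniformity of $X$; $\varepsilon[x]=\{y:(x,y)\in\varepsilon\}$. $A\subseteq T$ is (right) syndetic if there is a compact $K\subseteq T$ with $Kt\cap A\neq\emptyset$ for all $t\in T$. $(T,X)$ is syndetically distal if for every $x\in X$ and $\varepsilon\in\mathscr U_X$ there exist a syndetic $S\subseteq T$ and $\delta\in\mathscr U_X$ such that whenever $y\notin\varepsilon[x]$ we have $ty\notin\delta[tx]$ for all $t\in S$. A flow $(T,Z)$ is an a.p. flow if for every $\alpha$ in its uniformity there is a syndetic $A\subseteq T$ with $Az\subseteq\alpha[z]$ for all $z\in Z$. *)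

(* Defs.v *)
From mathcomp Require Import all_boot all_order all_algebra.
From mathcomp Require Import all_classical all_reals all_analysis.
Set Implicit Arguments. Unset Strict Implicit. Unset Printing Implicit Defensive.
Local Open Scope classical_set_scope.

Definition is_hausdorff_topological_group (T : topologicalType)
  (mul : T -> T -> T) (one : T) (inv : T -> T) : Prop :=
  [/\ (forall a b c, mul a (mul b c) = mul (mul a b) c),
      (forall a, mul one a = a /\ mul a one = a),
      (forall a, mul (inv a) a = one /\ mul a (inv a) = one),
      continuous (fun p : T * T => mul p.1 p.2) /\ continuous inv &
      hausdorff_space T].

Definition is_flow (T : topologicalType) (X : topologicalType)
  (mul : T -> T -> T) (one : T) (act : T -> X -> X) : Prop :=
  [/\ (forall x, act one x = x),
      (forall s t x, act (mul s t) x = act s (act t x)) &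
      continuous (fun p : T * X => act p.1 p.2)].

Definition syndetic (T : topologicalType) (mul : T -> T -> T) (A : set T) : Prop :=
  exists K : set T, compact K /\
    forall t : T, exists k, K k /\ A (mul k t).

Definition ent_section (X : Type) (eps : set (X * X)) (x : X) : set X :=
  [set y | eps (x, y)].

Definition syndetically_distal (T : topologicalType) (X : uniformType)
  (mul : T -> T -> T) (act : T -> X -> X) : Prop :=
  forall (x : X) (eps : set (X * X)), entourage eps ->
    exists (S : set T) (delta : set (X * X)),
      [/\ syndetic mul S, entourage delta &
          forall y, ~ ent_section eps x y ->
            forall t, S t -> ~ ent_section delta (act t x) (act t y)].

(* The subflow (T, Z), Z invariant, is an a.p. flow: for every entourage alpha
   of the (subspace) uniformity of Z -- i.e. the trace on Z of an entourage of X --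
   there is a syndetic A with A z included in alpha[z] for all z in Z. *)
Definition ap_subflow (T : topologicalType) (X : uniformType)
  (mul : T -> T -> T) (act : T -> X -> X) (Z : set X) : Prop :=
  forall alpha : set (X * X), entourage alpha ->
    exists A : set T, syndetic mul A /\
      forall z, Z z -> forall a, A a -> ent_section alpha z (act a z).

Definition orbit_closure (T : Type) (X : topologicalType)
  (act : T -> X -> X) (x : X) : set X :=
  closure [set act t x | t in [set: T]].

(* Main.v *)
Require Import Defs.
From mathcomp Require Import all_boot all_order all_algebra.
From mathcomp Require Import all_classical all_reals all_analysis.
Local Open Scope classical_set_scope.

(** A compact subset of [T] acts uniformly equicontinuously on [X], so syndetic
    distality says that for every [x] and [eps] some [delta] satisfies:
    [(t x, t y) \in delta] for a single [t] forces [(x, y) \in eps].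

    This makes the action equicontinuous at every point [w].  Suppose that
    [w_i --> w] and [t_i w --> x].  The property at [w] gives [t_i^-1 x --> w], so
    [t_i^-1 x] and [w_i] become close, and the property at [x] gives [t_i w_i --> x].

    By the Arzela-Ascoli argument finitely many [f \in T] approximate every [t \in T]
    uniformly on [X]; when [f] approximates [t^-1], the element [f t] moves every
    point little, so the set of such elements is syndetic. *)

Lemma entourage_split_sym (X : uniformType) (A : set (X * X)) : entourage A ->
  exists B : set (X * X), [/\ entourage B, forall x y, B (x, y) -> B (y, x) &
    forall x y z, B (x, y) -> B (y, z) -> A (x, z)].
Proof.
move=> eA; have eB := entourage_split_ent eA.
exists (split_ent A `&` (split_ent A)^-1)%relation; split.
- exact: entourage_invI.
- by move=> x y [].
- by move=> x y z [Axy _] [Ayz _]; exact: entourage_split Axy Ayz.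
Qed.

Lemma nbhs_ent_section (X : uniformType) (x : X) (A : set (X * X)) :
  entourage A -> nbhs x (ent_section A x).
Proof. by move=> eA; apply/nbhsP; exists A => // y; rewrite /xsection/= inE. Qed.

(** Morally a finite subcover gives finitely many entourages to intersect. Near-covering compactness
    does this at once, along the filter of families of small entourages. *)
Lemma compact_entourage (Y : topologicalType) (X : uniformType) (C : set Y)
    (P : set (X * X) -> Y -> Prop) :
  compact C -> (forall A B y, A `<=` B -> P B y -> P A y) ->
  (forall y, C y -> exists2 E, entourage E & \forall y' \near y, P E y') ->
  exists2 E, entourage E & forall y, C y -> P E y.
Proof.
move=> /compact_near_coveringP cC Pmono Ploc.
(* For empty [X] the empty relation is an entourage, so [entourage] is not a proper filter; all
   relations on [X] then coincide and any entourage works. *)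
have [x0|nX] := pselect (exists x : X, True); last first.
  exists setT; first exact: entourageT.
  move=> y Cy; have [E _ /nbhs_singleton PE] := Ploc y Cy.
  by apply: Pmono PE => p _; case: nX; exists p.1.
have pE : ProperFilter (@entourage X).
  apply: Build_ProperFilter_ex => A eA; case: x0 => x _; exists (x, x).
  exact: entourage_refl.
suff : \forall E \near powerset_filter_from (@entourage X), C `<=` P E.
  apply: (near_powerset_filter_fromP _ _).1 => A B AB CB y Cy.
  exact/(Pmono _ _ _ AB)/CB.
apply: cC => y Cy; have [E eE PE] := Ploc y Cy.
exists ([set y' | P E y'], [set E' | E' `<=` E]).
  by split => //=; exact: small_set_sub.
by move=> [y' E'] /= [PEy' E'E]; exact: Pmono E'E PEy'.
Qed.

Lemma compact_nbhs_cover {Y : topologicalType} (U : Y -> set Y) :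
  compact [set: Y] -> (forall y, nbhs y (U y)) ->
  exists s : seq Y, forall y, exists2 c, c \in s & U c y.
Proof.
move=> /compact_near_coveringP cY nU.
(* Lists are directed by inclusion of their elements: the points of [U y] are covered as soon as the
   list contains [y]. *)
pose G : set_system (seq Y) :=
  filter_from [set: seq Y] (fun s => [set s' | {subset s <= s'}]).
have filterG : Filter G.
  apply: filter_from_filter => [|s1 s2 _ _]; first by exists [::].
  exists (s1 ++ s2) => // s /= s12; split=> y ys; apply: s12;
    by rewrite mem_cat ys ?orbT.
have [|s _ Gs] := cY _ G (fun s y => exists2 c, c \in s & U c y) filterG.
  move=> y _; exists (U y, [set s | y \in s]).
    by split; [exact: nU | exists [:: y] => // s; apply; exact: mem_head].
  by move=> [y' s] /= [Uyy' ys]; exists y.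
by exists s => y; exact: (Gs s).
Qed.

(** Joint continuity provides an entourage near each pair [(k, x)], and compactness of the product
    of [K] and [X] makes it uniform. *)
Lemma compact_act_equicontinuous (T : topologicalType) (X : uniformType)
    (act : T -> X -> X) (K : set T) (A : set (X * X)) :
  continuous (fun p : T * X => act p.1 p.2) -> compact [set: X] -> compact K ->
  entourage A ->
  exists2 B, entourage B &
    forall k x y, K k -> B (x, y) -> A (act k x, act k y).
Proof.
move=> cact cX cK eA.
pose P (E : set (X * X)) (p : T * X) :=
  forall y, E (p.2, y) -> A (act p.1 p.2, act p.1 y).
have [E F p EF PF y /EF/PF //|[k x] _|E eE HE] :=
  compact_entourage _ X (K `*` [set: X]) P (compact_setX cK cX).
  have [B [eB sB BA]] := entourage_split_sym _ _ eA.
  have := cact (k, x) _ (nbhs_ent_section _ _ _ eB).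
  move=> [[N M] /= [nN /nbhsP[E0 eE0 E0M]] NM].
  have [E [eE sE EE]] := entourage_split_sym _ _ eE0.
  have M_section z : E0 (x, z) -> M z by move=> ?; apply: E0M; apply/xsectionP.
  exists E => //; exists (N, ent_section E x).
    by split => //=; exact: nbhs_ent_section.
  move=> [k' x'] /= [Nk' Exx'] y Ex'y.
  apply: (BA _ (act k x)).
    apply: sB; apply: (NM (k', x')); split => //=; apply: M_section.
    exact: EE Exx' (entourage_refl _ eE).
  by apply: (NM (k', y)); split => //=; apply: M_section; exact: EE Exx' Ex'y.
by exists E => // k x y Kk Exy; exact: (HE (k, x)).
Qed.

Section Flow.
Context {T : topologicalType} {X : uniformType}.
Context {mul : T -> T -> T} {one : T} {inv : T -> T} {act : T -> X -> X}.
Hypothesis groupT : is_hausdorff_topological_group mul one inv.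
Hypothesis compactX : compact [set: X].
Hypothesis flowX : is_flow mul one act.

Let actK t : cancel (act t) (act (inv t)).
Proof.
case: groupT => _ _ mulV _ _; case: flowX => act1 actM _ x.
by rewrite -actM (mulV t).1 act1.
Qed.

Let actVK t : cancel (act (inv t)) (act t).
Proof.
case: groupT => _ _ mulV _ _; case: flowX => act1 actM _ x.
by rewrite -actM (mulV t).2 act1.
Qed.

Lemma syndetically_distal_uniform : syndetically_distal mul act ->
  forall x (A : set (X * X)), entourage A ->
  exists2 B, entourage B &
    forall t y, B (act t x, act t y) -> A (x, y).
Proof.
case: flowX => _ actM cact sd x A eA.
have [S [D [[K [cK KS]] eD SD]]] := sd x A eA.
have [B eB BD] := compact_act_equicontinuous _ _ _ _ _ cact compactX cK eD.
exists B => // t y Bty; apply: contrapT => nAxy.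
(* The translate [k t] lies in [S], where distality applies, and [k] preserves the closeness of
   [t x] and [t y]. *)
have [k [Kk Skt]] := KS t.
by apply: (SD y nAxy _ Skt); rewrite /ent_section/= !actM; exact: BD.
Qed.

Lemma syndetically_distal_equicontinuous : syndetically_distal mul act ->
  forall w (A : set (X * X)), entourage A ->
  exists2 B, entourage B &
    forall t y, B (w, y) -> A (act t w, act t y).
Proof.
move=> /syndetically_distal_uniform sd w A eA.
(* Sorting the [t] by the position [x] of [t w] turns uniformity in [t] into a property local in
   [x], which compactness of [X] globalizes. *)
pose P (E : set (X * X)) (x : X) :=
  forall t y, act t w = x -> E (w, y) -> A (x, act t y).
have [E F p EF PF t y tw /EF/PF|x _|E eE PE] :=
  compact_entourage X X setT P compactX; last 1 first.
- by exists E => // t y Ewy; exact: (PE (act t w)).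
- exact.
have [A' [eA' sA' AA]] := entourage_split_sym _ _ eA.
have [D eD DA] := sd x A' eA'.
have [E [eE sE EE]] := entourage_split_sym _ _ eD.
have [H0 eH0 HE] := sd w E eE.
have [H [eH sH HH]] := entourage_split_sym _ _ eH0.
exists E => //; near=> x' => t y tw Ewy.
apply: (AA _ x).
  by apply: sA'; near: x'; exact: nbhs_ent_section.
(* The property at [x], used at time [inv t], leaves [inv t x] to be compared with [y], through
   [w]. *)
apply: (DA (inv t)); rewrite actK; apply: EE Ewy; apply: sE.
(* The property at [w], used at time [t], reduces closeness of [w] and [inv t x] to that of [x'] and
   [x]. *)
apply: (HE t); rewrite actVK tw; apply: HH (entourage_refl _ eH).
by apply: sH; near: x'; exact: nbhs_ent_section.
Unshelve. all: by end_near.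
Qed.

(* Restricting the approximants to [S] makes the induction on the list go through:
   one splits [S] according to the position of [t x], and recurses in each piece. *)
Lemma finite_approx_on_seq (A : set (X * X)) (s : seq X) (S : set T) :
  entourage A ->
  exists F : set T, [/\ finite_set F, F `<=` S & forall t, S t ->
    exists2 f, F f & forall x, x \in s -> A (act f x, act t x)].
Proof.
move=> eA; have [B [eB sB BA]] := entourage_split_sym _ _ eA.
have [cs cscov] := compact_nbhs_cover (ent_section B) compactX
  (fun y => nbhs_ent_section _ _ _ eB).
elim: s S => [|x s IHs] S.
  have [[t St]|S0] := pselect (exists t, S t).
    exists [set t]; split=> [|_ -> //|u Su]; first exact: finite_set1.
    by exists t.
  by exists set0; split=> [|//|t St]; [exact: finite_set0|case: S0; exists t].
have [G GP] := choice (fun c => IHs (S `&` [set t | B (c, act t x)])).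
exists (\bigcup_(c in [set` cs]) G c); split.
- apply: bigcup_finite; first exact: finite_seq.
  by move=> c _; have [] := GP c.
- by move=> t [c _ Gct]; have [_ /(_ t Gct) []] := GP c.
- move=> t St; have [c cs_c Bct] := cscov (act t x).
  have [_ GS /(_ t (conj St Bct)) [f Gf fP]] := GP c.
  exists f => [|y]; first by exists c.
  rewrite inE => /orP[/eqP ->|]; last exact: fP.
  by apply: BA Bct; apply: sB; have [] := GS f Gf.
Qed.

Lemma equicontinuous_finite_approx :
  (forall w (A : set (X * X)), entourage A -> exists2 B, entourage B &
    forall t y, B (w, y) -> A (act t w, act t y)) ->
  forall A : set (X * X), entourage A ->
  exists2 F : set T, finite_set F &
    forall t, exists2 f, F f & forall x, A (act f x, act t x).
Proof.
move=> eqc A eA.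
have [B [eB sB BA]] := entourage_split_sym _ _ eA.
have [C [eC sC CB]] := entourage_split_sym _ _ eB.
have [D DP] := choice (fun w => (exists2P _ _).1 (eqc w C eC)).
have [s scov] := compact_nbhs_cover (fun w => ent_section (D w) w) compactX
  (fun w => nbhs_ent_section _ _ _ (DP w).1).
have [F [finF _ FP]] := finite_approx_on_seq C s setT eC.
exists F => // t; have [f Ff ft] := FP t I.
exists f => // x; have [c cs Dcx] := scov x.
have Cx u : C (act u c, act u x) by apply: (DP c).2.
(* The chain is [f x], [f c], [t c], [t x]: equicontinuity at [c] gives the outer links, and
   approximation on the finite net [s] the middle one. *)
apply: (BA _ (act t c)).
  by apply: (CB _ (act f c)); [exact/sC/Cx | exact: ft].
exact: CB (entourage_refl _ eC) (Cx t).
Qed.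

Lemma finite_approx_ap (Z : set X) :
  (forall A : set (X * X), entourage A -> exists2 F : set T, finite_set F &
    forall t, exists2 f, F f & forall x, A (act f x, act t x)) ->
  ap_subflow mul act Z.
Proof.
case: flowX => _ actM _ approx A eA.
(* The inverse entourage is taken because evaluating the approximation of [inv t] at [t z] yields
   the pair [(f t z, z)], in reversed order. *)
have [F finF FP] := approx _ (entourage_inv eA).
exists [set a | forall z, A (z, act a z)]; split; last by move=> z _ a; exact.
exists F; split; first exact: finite_compact.
move=> t; have [f Ff ft] := FP (inv t).
exists f; split=> // z.
by have := ft (act t z); rewrite actK actM.
Qed.

End Flow.

Theorem theorem2p10 (T : topologicalType) (X : uniformType)
  (mul : T -> T -> T) (one : T) (inv : T -> T) (act : T -> X -> X) :
  is_hausdorff_topological_group mul one inv ->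
  compact [set: X] -> hausdorff_space X ->
  is_flow mul one act ->
  syndetically_distal mul act ->
  forall x : X, ap_subflow mul act (orbit_closure act x).
Proof.
move=> groupT compactX _ flowX sd x.
apply: (finite_approx_ap groupT flowX).
apply: (equicontinuous_finite_approx compactX).
exact: (syndetically_distal_equicontinuous groupT compactX flowX).
Qed.
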